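(* Let the $R$-vertex weights $R_{\Gamma\Gamma},R_{\Delta\Gamma},R_{\Delta\Delta}$ and the cap weights $\mathcal C$ be as defined in the context, with spectral parameters $x,y$. Then for any colors $\epsilon_1,\epsilon_2,\epsilon_3,\epsilon_4\in\{0\}\cup[\pm n]$, $$\sum_{p,u,v,w}R_{\Delta\Delta}(\epsilon_2,\epsilon_1,p,u;x,y)\,R_{\Delta\Gamma}(\epsilon_3,u,v,w;x,y)\,\mathcal C_y(v,p)\,\mathcal C_x(\epsilon_4,w)=\sum_{p,u,v,w}R_{\Gamma\Gamma}(\epsilon_4,\epsilon_3,u,p;y,x)\,R_{\Delta\Gamma}(u,\epsilon_2,v,w;y,x)\,\mathcal C_y(p,w)\,\mathcal C_x(v,\epsilon_1),$$ where in both sums $p,u,v,w$ range over $\{0\}\cup[\pm n]$.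
   Context: **Colors.** Fix an integer $n\ge1$. The signed colors are $[\pm n]=\{1,\dots,n,\overline n,\dots,\overline 1\}$, with $[n]=\{1,\dots,n\}$; there is also a color $0$ (also written $+$). Ordering: $1<\cdots<n<0<\overline n<\cdots<\overline1$. **Parameters.** $q,\nu,t\in\mathbb C$ and spectral parameters $x,y\in\mathbb C$, with a fixed square root $q^{1/2}$ of $q$, such that all denominators that occur are nonzero (in particular $q,\nu,x,y\neq0$). **$R$ weights.** $R_{XY}(\alpha,\beta,\gamma,\delta;x,y)$, for $(X,Y)\in\{(\Gamma,\Gamma),(\Delta,\Gamma),(\Delta,\Delta)\}$, is the weight of an $X$-$Y$ vertex with spectral parameters $x,y$ and with bottom-left edge $\alpha$, top-left edge $\beta$, top-right edge $\gamma$, bottom-right edge $\delta$ in $\{0\}\cup[\pm n]$. The only nonzero values are the following, where $i,j\in\{0\}\cup[\pm n]$, $i<j$ (and $(i,i,i,i)$ is for any $i$): - $R_{\Gamma\Gamma}$: $(i,i,i,i)\mapsto1$; $(i,j,i,j)\mapsto\frac{x-y}{x-qy}$; $(j,i,j,i)\mapsto\frac{q(x-y)}{x-qy}$; $(j,i,i,j)\mapsto\frac{(1-q)x}{x-qy}$; $(i,j,j,i)\mapsto\frac{(1-q)y}{x-qy}$. - $R_{\Delta\Gamma}$: $(i,i,i,i)\mapsto1$; $(i,j,i,j)\mapsto\frac{qxy-1}{xy-1}$; $(j,i,j,i)\mapsto\frac{qxy-1}{q(xy-1)}$; $(j,j,i,i)\mapsto\frac{1-q}{q(xy-1)}$; $(i,i,j,j)\mapsto\frac{(1-q)xy}{xy-1}$.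 - $R_{\Delta\Delta}$: $(i,i,i,i)\mapsto1$; $(i,j,i,j)\mapsto\frac{y-x}{y-qx}$; $(j,i,j,i)\mapsto\frac{q(y-x)}{y-qx}$; $(j,i,i,j)\mapsto\frac{(1-q)x}{y-qx}$; $(i,j,j,i)\mapsto\frac{(1-q)y}{y-qx}$. (In the expressions $R_{XY}(\cdot;y,x)$ the roles of $x$ and $y$ in these formulas are exchanged.) **Cap weights.** Let $\phi(x)=\frac{1-x^2}{(1-\nu tx)(1+\nu^{-1}x)}$. Let $\mathcal C_x(a,b)$ be the weight of a cap with spectral parameter $x$, bottom edge $a$ and top edge $b$: $\mathcal C_x(0,0)=1$, and for $i\in[n]$, $\mathcal C_x(i,\overline i)=t\phi(q^{-1/2}x^{-1})$, $\mathcal C_x(i,i)=1-t\phi(q^{-1/2}x^{-1})$, $\mathcal C_x(\overline i,i)=\phi(q^{-1/2}x^{-1})$, $\mathcal C_x(\overline i,\overline i)=1-\phi(q^{-1/2}x^{-1})$; all other values are $0$. *)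

(* Defs.v *)
From HB Require Import structures.
From mathcomp Require Import all_boot all_order all_algebra.
From mathcomp Require Import reals.
From mathcomp Require Export complex.

Set Implicit Arguments.
Unset Strict Implicit.
Unset Printing Implicit Defensive.

Import GRing.Theory.
Local Open Scope ring_scope.

(* The set {0} \cup [±n]. Indices are shifted by one: [Pos i] and [Neg i] are
   the colors i+1 and its barred version. *)
Inductive color (n : nat) : Type :=
  | Pos of 'I_n
  | Zero
  | Neg of 'I_n.
Arguments Zero {n}.

Definition color_code n (c : color n) : option ('I_n + 'I_n) :=
  match c with
  | Pos i => Some (inl i)
  | Zero => None
  | Neg i => Some (inr i)
  end.

Definition color_decode n (s : option ('I_n + 'I_n)) : color n :=
  match s with
  | Some (inl i) => Pos i
  | None => Zero
  | Some (inr i) => Neg i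
  end.

Lemma color_codeK n : cancel (@color_code n) (@color_decode n).
Proof. by case. Qed.

HB.instance Definition _ n :=
  Countable.copy (color n) (can_type (@color_codeK n)).
HB.instance Definition _ n : isFinite (color n) :=
  CanIsFinite (@color_codeK n).

(* Position in the chain 1 < ... < n < 0 < \bar n < ... < \bar 1. *)
Definition color_rank n (c : color n) : nat :=
  match c with
  | Pos i => i
  | Zero => n
  | Neg i => (n.*2 - i)%N
  end.

Definition color_lt n (a b : color n) : bool :=
  (color_rank a < color_rank b)%N.

(* R-vertex weights. The arguments a b c d are the bottom-left, top-left,
   top-right and bottom-right edges; the branches have disjoint conditions. *)
Section Weights.
Variables (K : fieldType) (n : nat).
Implicit Types (q nu t s x y : K) (a b c d : color n).

Definition R_GammaGamma q a b c d x y : K :=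
  if [&& a == b, b == c & c == d] then 1
  else if [&& a == c, b == d & color_lt a b] then (x - y) / (x - q * y)
  else if [&& a == c, b == d & color_lt b a] then q * (x - y) / (x - q * y)
  else if [&& a == d, b == c & color_lt b a] then (1 - q) * x / (x - q * y)
  else if [&& a == d, b == c & color_lt a b] then (1 - q) * y / (x - q * y)
  else 0.

Definition R_DeltaGamma q a b c d x y : K :=
  if [&& a == b, b == c & c == d] then 1
  else if [&& a == c, b == d & color_lt a b] then
    (q * x * y - 1) / (x * y - 1)
  else if [&& a == c, b == d & color_lt b a] then
    (q * x * y - 1) / (q * (x * y - 1))
  else if [&& a == b, c == d & color_lt c a] then
    (1 - q) / (q * (x * y - 1))
  else if [&& a == b, c == d & color_lt a c] then
    (1 - q) * x * y / (x * y - 1)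
  else 0.

Definition R_DeltaDelta q a b c d x y : K :=
  if [&& a == b, b == c & c == d] then 1
  else if [&& a == c, b == d & color_lt a b] then (y - x) / (y - q * x)
  else if [&& a == c, b == d & color_lt b a] then q * (y - x) / (y - q * x)
  else if [&& a == d, b == c & color_lt b a] then (1 - q) * x / (y - q * x)
  else if [&& a == d, b == c & color_lt a b] then (1 - q) * y / (y - q * x)
  else 0.

Definition phi nu t x : K :=
  (1 - x ^+ 2) / ((1 - nu * t * x) * (1 + nu^-1 * x)).

(* [s] is the chosen square root of q, a the bottom and b the top edge. *)
Definition cap nu t s x a b : K :=
  let f := phi nu t (s^-1 * x^-1) in
  match a, b with
  | Zero, Zero => 1
  | Pos i, Neg j => if i == j then t * f else 0
  | Pos i, Pos j => if i == j then 1 - t * f else 0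
  | Neg i, Pos j => if i == j then f else 0
  | Neg i, Neg j => if i == j then 1 - f else 0
  | _, _ => 0
  end.

End Weights.

(* Main.v *)
(* Each cap sends a color [a] to [a] or to its bar, and each R-vertex preserves
   absolute values of colors, so both sums collapse to a few terms. They vanish
   unless the absolute values of the colors on the edges 1, 2 agree with those
   on the edges 3, 4 up to order. What remains depends only on the signs and the
   relative order of two colors: finitely many identities of rational functions.
   These hold because, with z = s (1/nu - nu t), the value of phi in the cap with
   parameter x is (q x^2 - 1) / (q x^2 + z x - t), where z does not depend on x. *)
Require Import Defs.
From mathcomp Require Import all_boot all_order all_algebra.
From mathcomp Require Import reals complex.
From mathcomp Require Import ring zify.

Import GRing.Theory.
Local Open Scope ring_scope.

Section Colors.
Set Implicit Arguments.
Unset Strict Implicit.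
Variable n : nat.
Implicit Types (a b c d : color n) (i j : 'I_n).

Definition bar a :=
  match a with Pos i => Neg i | Zero => Zero | Neg i => Pos i end.

Lemma barK : involutive bar. Proof. by case. Qed.

Definition abs_eq a b := (a == b) || (a == bar b).

Lemma abs_eq_barl a b : abs_eq (bar a) b = abs_eq a b.
Proof. by rewrite /abs_eq (inv_eq barK) (inj_eq (inv_inj barK)) orbC. Qed.

Lemma abs_eq_barr a b : abs_eq a (bar b) = abs_eq a b.
Proof. by rewrite /abs_eq barK orbC. Qed.

Lemma abs_eqC a b : abs_eq a b = abs_eq b a.
Proof. by rewrite /abs_eq eq_sym -(inv_eq barK) [bar a == b]eq_sym. Qed.

(** Equality is reduced to indices in [nat], so that one [ltngtP] later settles it together with the
    order tests of [color_ltE]. *)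
Lemma color_eqE :
  (forall i j, (Pos i == Pos j) = (i == j :> nat)) *
  (forall i j, (Neg i == Neg j) = (i == j :> nat)) *
  (forall i j, (Pos i == Neg j) = false) *
  (forall i j, (Neg i == Pos j) = false) *
  (forall i, (Pos i == Zero) = false) *
  (forall i, (Neg i == Zero) = false) *
  (forall i, (Zero == Pos i) = false) *
  (forall i, (Zero == Neg i) = false).
Proof. by []. Qed.

Lemma color_ltE :
  (forall i j, color_lt (Pos i) (Pos j) = (i < j)%N) *
  (forall i j, color_lt (Neg i) (Neg j) = (j < i)%N) *
  (forall i j, color_lt (Pos i) (Neg j) = true) *
  (forall i j, color_lt (Neg i) (Pos j) = false) *
  (forall i, color_lt (Pos i) Zero = true) *
  (forall i, color_lt (Neg i) Zero = false) *
  (forall i, color_lt Zero (Pos i) = false) *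
  (forall i, color_lt Zero (Neg i) = true).
Proof.
by rewrite /color_lt /=; do ![split] => i; (try move=> j; move: (ltn_ord i));
  try (move: (ltn_ord j)); rewrite -?addnn; lia.
Qed.
End Colors.

Lemma sum_pick (I : finType) (K : pzSemiRingType) (a : I) (c F : I -> K) :
  \sum_b (if b == a then c b else 0) * F b = c a * F a.
Proof.
rewrite (bigD1 a) //= eqxx big1 ?addr0 // => b /negPf ->.
by rewrite mul0r.
Qed.

Section Weights.
Set Implicit Arguments.
Unset Strict Implicit.
Variables (K : fieldType) (n : nat).
Implicit Types (q nu t s x y : K) (a b c d : color n) (F : color n -> K).

(* With [f] the value of phi, this is the weight of the cap turning [a] into
   [bar a]; the value at [Zero] is irrelevant, because [bar Zero = Zero]. *)
Definition flip t f a : K :=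
  match a with Pos _ => t * f | Zero => 0 | Neg _ => f end.

Lemma capE nu t s x a b (f := phi nu t (s^-1 * x^-1)) :
  cap nu t s x a b = (if a == b then 1 - flip t f a else 0)
                     + (if a == bar b then flip t f a else 0).
Proof.
rewrite /cap -/f; case: a b => [i||i] [j||j]; rewrite /flip /bar ?color_eqE ?eqxx ?addr0 ?add0r //.
by rewrite subr0.
Qed.

Lemma cap_sumr nu t s x a F (f := phi nu t (s^-1 * x^-1)) :
  \sum_b cap nu t s x a b * F b
  = (1 - flip t f a) * F a + flip t f a * F (bar a).
Proof.
under eq_bigr => b _ do
  rewrite capE mulrDl -(inv_eq (@barK n)) [a == b]eq_sym [bar a == b]eq_sym.
by rewrite big_split /= (sum_pick a (fun=> _)) (sum_pick (bar a) (fun=> _)).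
Qed.

(** The flip weight depends on the bottom edge, here the summation variable, so the flipped term
    carries [bar b], unlike in [cap_sumr]. *)
Lemma cap_suml nu t s x b F (f := phi nu t (s^-1 * x^-1)) :
  \sum_a cap nu t s x a b * F a
  = (1 - flip t f b) * F b + flip t f (bar b) * F (bar b).
Proof.
under eq_bigr => a _ do rewrite capE mulrDl.
by rewrite big_split /= (sum_pick b (fun a => 1 - flip t _ a)) sum_pick.
Qed.

(** Serves the two vertex types whose right edges permute their left edges; the test [a == b] avoids
    counting one term twice. *)
Lemma sum_swap (W F : color n -> color n -> K) a b :
    (forall c d, (c, d) != (a, b) -> (c, d) != (b, a) -> W c d = 0) ->
  \sum_c \sum_d W c d * F c d
  = W a b * F a b + (if a == b then 0 else W b a * F b a).
Proof.
move=> W0; rewrite pair_bigA (bigD1 (a, b)) //=; congr (_ + _).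
case: eqVneq W0 => [<-|ne_ab] W0.
  by apply: big1 => -[c d] /= ne_cd; rewrite W0 ?mul0r.
rewrite (bigD1 (b, a)) /=; last by rewrite xpair_eqE negb_and eq_sym ne_ab.
by rewrite big1 ?addr0 // => -[c d] /= /andP[/W0 W0' /W0' ->]; rewrite mul0r.
Qed.

Lemma R_DeltaDelta_sum q a b x y (F : color n -> color n -> K) :
  \sum_c \sum_d R_DeltaDelta q a b c d x y * F c d
  = R_DeltaDelta q a b a b x y * F a b
    + (if a == b then 0 else R_DeltaDelta q a b b a x y * F b a).
Proof.
apply: (@sum_swap (fun c d => R_DeltaDelta q a b c d x y) F a b) => c d.
rewrite /R_DeltaDelta !xpair_eqE ![c == _]eq_sym ![d == _]eq_sym.
case: ifP => [/and3P[/eqP-> /eqP-> /eqP->]|_]; first by rewrite eqxx.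
by case: (a == c); case: (b == d); case: (b == c); case: (a == d).
Qed.

Lemma R_GammaGamma_sum q a b x y (F : color n -> color n -> K) :
  \sum_c \sum_d R_GammaGamma q a b c d x y * F c d
  = R_GammaGamma q a b a b x y * F a b
    + (if a == b then 0 else R_GammaGamma q a b b a x y * F b a).
Proof.
apply: (@sum_swap (fun c d => R_GammaGamma q a b c d x y) F a b) => c d.
rewrite /R_GammaGamma !xpair_eqE ![c == _]eq_sym ![d == _]eq_sym.
case: ifP => [/and3P[/eqP-> /eqP-> /eqP->]|_]; first by rewrite eqxx.
by case: (a == c); case: (b == d); case: (b == c); case: (a == d).
Qed.

(** A nonzero weight has [a = b] and [c = d], or [a = c] and [b = d]. The form up to bars also
    covers edges flipped by a cap. *)
Lemma R_DeltaGamma_eq0 q a b c d x y :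
  ~~ (abs_eq a b && abs_eq c d) -> ~~ (abs_eq a c && abs_eq b d) ->
  R_DeltaGamma q a b c d x y = 0.
Proof.
rewrite /R_DeltaGamma /abs_eq.
case: (a == b); case: (c == d) => //=; case: (a == c); case: (b == d) => //=;
  by rewrite andbF.
Qed.

(** Multiplying numerator and denominator of [phi] by [(s * x) ^+ 2] turns the denominator into
    [(s * x - nu * t) * (s * x + nu^-1)]. *)
Lemma phiE q nu t s x :
    s ^+ 2 = q -> q != 0 -> nu != 0 -> x != 0 ->
    1 - nu * t * (s^-1 * x^-1) != 0 -> 1 + nu^-1 * (s^-1 * x^-1) != 0 ->
  q * x ^+ 2 + s * (nu^-1 - nu * t) * x - t != 0 /\
  phi nu t (s^-1 * x^-1)
    = (q * x ^+ 2 - 1) / (q * x ^+ 2 + s * (nu^-1 - nu * t) * x - t).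
Proof.
move=> <- + nu0 x0 h1 h2; rewrite sqrf_eq0 => s0.
have eqD : s ^+ 2 * x ^+ 2 + s * (nu^-1 - nu * t) * x - t
    = (s * x) ^+ 2
      * ((1 - nu * t * (s^-1 * x^-1)) * (1 + nu^-1 * (s^-1 * x^-1))).
  by field; rewrite nu0 x0 s0.
have D0 : s ^+ 2 * x ^+ 2 + s * (nu^-1 - nu * t) * x - t != 0 by rewrite eqD !mulf_neq0.
split=> //; apply/eqP; rewrite /phi eqr_div ?mulf_neq0 //; apply/eqP.
by rewrite eqD; field; rewrite nu0 x0 s0.
Qed.

Lemma reflection_equation q nu t s x y a b c d :
    s ^+ 2 = q -> q != 0 -> nu != 0 -> x != 0 -> y != 0 ->
    y - q * x != 0 -> x * y - 1 != 0 ->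
    1 - nu * t * (s^-1 * x^-1) != 0 -> 1 + nu^-1 * (s^-1 * x^-1) != 0 ->
    1 - nu * t * (s^-1 * y^-1) != 0 -> 1 + nu^-1 * (s^-1 * y^-1) != 0 ->
  \sum_p \sum_u \sum_v \sum_w
    R_DeltaDelta q b a p u x y * R_DeltaGamma q c u v w x y
      * cap nu t s y v p * cap nu t s x d w
  = \sum_p \sum_u \sum_v \sum_w
    R_GammaGamma q d c u p y x * R_DeltaGamma q u b v w y x
      * cap nu t s y p w * cap nu t s x v a.
Proof.
move=> hs hq hnu hx hy hyx hxy hx1 hx2 hy1 hy2.
have hyx1 : y * x - 1 != 0 by rewrite mulrC.
move: (phiE hs hq hnu hx hx1 hx2) (phiE hs hq hnu hy hy1 hy2).
(* With this coefficient abstracted, the final identities are rational in [q], [t], [x], [y] and a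
   free [z]. *)
move: (s * (nu^-1 - nu * t)) => z [Dx0 phix] [Dy0 phiy].
pose f := phi nu t (s^-1 * x^-1); pose g := phi nu t (s^-1 * y^-1).
pose kx := flip t f; pose ky := flip t g.
(* On the left, [H] is the result of summing over [v], and [L] of then summing over [w]; on the
   right, [H'] sums over [w] and [M] then over [v]. *)
pose H w p u := (1 - ky p) * R_DeltaGamma q c u p w x y
                + ky (bar p) * R_DeltaGamma q c u (bar p) w x y.
pose L p u := (1 - kx d) * H d p u + kx d * H (bar d) p u.
pose H' v u p := (1 - ky p) * R_DeltaGamma q u b v p y x
                 + ky p * R_DeltaGamma q u b v (bar p) y x.
pose M u p := (1 - kx a) * H' a u p + kx (bar a) * H' (bar a) u p.
transitivity (\sum_p \sum_u R_DeltaDelta q b a p u x y * L p u).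
  apply: eq_bigr => p _; apply: eq_bigr => u _; rewrite /L.
  rewrite -(cap_sumr nu t s x d (fun w => H w p u)) big_distrr exchange_big /=.
  apply: eq_bigr => w _; rewrite /H.
  rewrite -(cap_suml nu t s y p (fun v => R_DeltaGamma q c u v w x y)).
  by rewrite !big_distrr; apply: eq_bigr => v _ /=; ring.
transitivity (\sum_u \sum_p R_GammaGamma q d c u p y x * M u p); last first.
  rewrite exchange_big; apply: eq_bigr => p _; apply: eq_bigr => u _; rewrite /M.
  rewrite -(cap_suml nu t s x a (fun v => H' v u p)) big_distrr /=.
  apply: eq_bigr => v _; rewrite /H'.
  rewrite -(cap_sumr nu t s y p (fun w => R_DeltaGamma q u b v w y x)).
  by rewrite !big_distrr; apply: eq_bigr => w _ /=; ring.
rewrite R_DeltaDelta_sum R_GammaGamma_sum {}/L {}/M {}/H {}/H'.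
(* Up to bars, every remaining [R_DeltaGamma] has edges [a], [b], [c], [d], and its two admissible
   pairings are the two alternatives here. *)
have [hc|hc] := boolP ((abs_eq c a && abs_eq d b) || (abs_eq c b && abs_eq d a));
  last first.
  move: hc; rewrite negb_or => /andP[hc1 hc2].
  rewrite !R_DeltaGamma_eq0 ?(abs_eq_barl, abs_eq_barr);
    rewrite ?[abs_eq a _]abs_eqC ?[abs_eq b _]abs_eqC ?hc1 ?hc2 //;
    try by rewrite andbC ?hc1 ?hc2.
  by rewrite !(mulr0, addr0) !if_same.
case/orP: hc => /andP[/orP[/eqP->|/eqP->] /orP[/eqP->|/eqP->]];
  case: a b => [i||i] [j||j];
  rewrite /R_DeltaDelta /R_DeltaGamma /R_GammaGamma /bar ?color_eqE ?color_ltE;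
  try (case: (ltngtP i j) => _); rewrite ?eqxx ?ltnn /=;
  rewrite /kx /ky /flip /f /g ?phix ?phiy;
  (* [R_DeltaDelta] at [x y] and [R_GammaGamma] at [y x] share the denominator [y - q * x]. *)
  by field; rewrite ?hq ?hyx ?hxy ?hyx1 ?Dx0 ?Dy0.
Qed.
End Weights.

Theorem proposition2p2 (R : realType) (n : nat) (q nu t s x y : R[i])
    (e1 e2 e3 e4 : color n)
    (hn : (1 <= n)%N)
    (hs : s ^+ 2 = q)
    (hq : q != 0) (hnu : nu != 0) (hx : x != 0) (hy : y != 0)
    (hyx : y - q * x != 0)
    (hxy : x * y - 1 != 0)
    (hphix1 : 1 - nu * t * (s^-1 * x^-1) != 0)
    (hphix2 : 1 + nu^-1 * (s^-1 * x^-1) != 0)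
    (hphiy1 : 1 - nu * t * (s^-1 * y^-1) != 0)
    (hphiy2 : 1 + nu^-1 * (s^-1 * y^-1) != 0) :
  \sum_(p : color n) \sum_(u : color n) \sum_(v : color n) \sum_(w : color n)
    R_DeltaDelta q e2 e1 p u x y * R_DeltaGamma q e3 u v w x y
      * cap nu t s y v p * cap nu t s x e4 w
  = \sum_(p : color n) \sum_(u : color n) \sum_(v : color n) \sum_(w : color n)
    R_GammaGamma q e4 e3 u p y x * R_DeltaGamma q u e2 v w y x
      * cap nu t s y p w * cap nu t s x v e1.
Proof. exact: reflection_equation. Qed.
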